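(* Let $\mathbb{F}$ be a field, let $n\ge 1$, and let $A$ be an $n\times n$ matrix over $\mathbb{F}$ with transpose $A^T$. Then $\det(A^T)=\det(A)$.
   Context: Given a vector space $V$ over a field $\mathbb{F}$ and an integer $n\ge 1$, an $n$-determinant on $V$ is a function $D:V^n\to\mathbb{F}$ that is not identically zero, such that for all $v_1,\ldots,v_n,b\in V$ one has $$D(v_1,\ldots,v_n)\cdot b=\sum_{k=1}^n D(v_1,\ldots,v_{k-1},b,v_{k+1},\ldots,v_n)\cdot v_k,$$ and such that $V$ is not spanned by any $n-1$ vectors of $V$ (so that $V$ has dimension $n$ over $\mathbb{F}$). The vector space $\mathbb{F}^n$ has a unique $n$-determinant, denoted $\det$, such that $\det(e_1,\ldots,e_n)=1$, where $e_1,\ldots,e_n$ is the standard basis. For an $n\times n$ matrix $A$ over $\mathbb{F}$ with rows $r_1,\ldots,r_n\in\mathbb{F}^n$, $\det(A)$ means $\det(r_1,\ldots,r_n)$. *)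

(* Defs.v *)
From HB Require Import structures.
From mathcomp Require Import all_boot all_order all_algebra.

Set Implicit Arguments.
Unset Strict Implicit.
Unset Printing Implicit Defensive.

Import GRing.Theory.
Local Open Scope ring_scope.

(* [(V ^ n)%type] is [{ffun 'I_n -> V}]. *)

Definition replace_at (T : Type) (n : nat) (v : (T ^ n)%type) (k : 'I_n)
    (b : T) : (T ^ n)%type :=
  [ffun j => if j == k then b else v j].

Definition spans (F : fieldType) (V : lmodType F) (m : nat)
    (w : (V ^ m)%type) : Prop :=
  forall x : V, exists c : 'I_m -> F, x = \sum_(i < m) c i *: w i.

(* Meaningful for [0 < n] only: at [n = 0] the predecessor [n.-1] is [0]. *)
Record is_determinant (F : fieldType) (V : lmodType F) (n : nat)
    (D : (V ^ n)%type -> F) : Prop := IsDeterminant {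
  determinant_nonzero : exists v : (V ^ n)%type, D v <> 0;
  determinant_exchange : forall (v : (V ^ n)%type) (b : V),
    D v *: b = \sum_(k < n) D (replace_at v k b) *: v k;
  determinant_not_spanned : forall w : (V ^ n.-1)%type, ~ spans w
}.

Definition std_basis (F : fieldType) (n : nat) : ('rV[F]_n ^ n)%type :=
  [ffun i => delta_mx 0 i].

Definition mx_rows (F : fieldType) (n : nat) (A : 'M[F]_n) :
    ('rV[F]_n ^ n)%type :=
  [ffun i => row i A].

Definition is_std_determinant (F : fieldType) (n : nat)
    (D : ('rV[F]_n ^ n)%type -> F) : Prop :=
  is_determinant D /\ D (std_basis F n) = 1.

(* [is_std_determinant] is satisfiable, so quantifying over the functions that
   satisfy it is not vacuous. *)
Lemma std_determinant_exists (F : fieldType) (n : nat) (n_gt0 : (0 < n)%N) :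
  exists D : ('rV[F]_n ^ n)%type -> F, is_std_determinant D.
Proof.
have D1 : \det (\matrix_i std_basis F n i) = 1.
  rewrite -(det1 F n); congr (\det _); apply/matrixP=> i j.
  by rewrite !mxE ffunE !mxE eqxx eq_sym.
exists (fun v => \det (\matrix_i v i)); split=> //; split.
- by exists (std_basis F n); rewrite D1; apply/eqP; exact: oner_neq0.
- move=> v b; set M := \matrix_i v i.
  have -> : \det M *: b = (b *m \adj M) *m M.
    by rewrite -mulmxA mul_adj_mx mul_mx_scalar.
  rewrite mulmx_sum_row; apply: eq_bigr => k _.
  rewrite rowK; congr (_ *: _); rewrite mxE.
  rewrite (expand_det_row _ k); apply: eq_bigr => j _.
  rewrite !mxE ffunE eqxx; congr (_ * _).
  rewrite /cofactor; congr (_ * \det _); apply/matrixP=> s t.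
  by rewrite !mxE ffunE eq_sym (negPf (neq_lift _ _)).
- move=> w sp; pose W : 'M[F]_(n.-1, n) := \matrix_i w i.
  have sub1 : (1%:M <= W)%MS.
    apply/row_subP=> i; have [c ->] := sp (row i 1%:M).
    apply: summx_sub => k _; apply: scalemx_sub.
    by rewrite -[w k](rowK (fun i => w i)) row_sub.
  have := leq_trans (mxrankS sub1) (rank_leq_row W).
  by rewrite mxrank1 leqNgt ltn_predL n_gt0.
Qed.

(* Main.v *)
(** A function that satisfies the exchange identity vanishes on dependent
    families, and by uniqueness of coordinates it is multiplied by [c k] when
    entry [k] of [v] is replaced by [\sum_l c l *: v l]. The second property
    yields the sign change under transpositions and allows replacing the rows
    of an invertible matrix one at a time by standard basis vectors, so that the
    function is determined by its value on the standard basis. Hence it is the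
    Leibniz determinant, which is invariant under transposition. *)

Require Import Defs.
From HB Require Import structures.
From mathcomp Require Import all_boot all_order all_fingroup all_algebra.

Set Implicit Arguments.
Unset Strict Implicit.
Unset Printing Implicit Defensive.

Import GRing.Theory.
Local Open Scope ring_scope.

Definition exchange (F : fieldType) (n : nat) (D : ('rV[F]_n ^ n)%type -> F) :=
  forall (v : ('rV[F]_n ^ n)%type) (b : 'rV[F]_n),
    D v *: b = \sum_(k < n) D (replace_at v k b) *: v k.

(** Cramer's rule: expansion along row [k] shows that entry [k] of [b *m \adj M] is the determinant
    of [M] with row [k] replaced by [b], and [\adj M *m M] is the scalar matrix of [\det M]. *)
Lemma det_exchange (F : fieldType) (n : nat) :
  @exchange F n (fun v => \det (\matrix_i v i)).
Proof.
move=> v b; set M := \matrix_i v i.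
have -> : \det M *: b = (b *m \adj M) *m M.
  by rewrite -mulmxA mul_adj_mx mul_mx_scalar.
rewrite mulmx_sum_row; apply: eq_bigr => k _.
rewrite rowK mxE (expand_det_row _ k); congr (_ *: _).
apply: eq_bigr => j _; rewrite !mxE ffunE eqxx; congr (_ * (_ * \det _)).
by apply/matrixP => s t; rewrite !mxE ffunE eq_sym (negPf (neq_lift _ _)).
Qed.

Section ExchangeTheory.

Variables (F : fieldType) (n : nat) (D : ('rV[F]_n ^ n)%type -> F).
Hypothesis exD : exchange D.
Implicit Types (v : ('rV[F]_n ^ n)%type) (c : 'rV[F]_n) (i j k : 'I_n).

(** If [D v] were nonzero, dividing the exchange identity by it would write every vector as a
    combination of the [v i]. *)
Lemma exchange_singular v : \matrix_i v i \notin unitmx -> D v = 0.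
Proof.
move=> Msing; apply/eqP; apply: contraNT Msing => Dv_neq0.
rewrite -row_full_unit -sub1mx; apply/row_subP => r.
rewrite -(eqmx_scale _ Dv_neq0) exD; apply: summx_sub => k _.
by apply: scalemx_sub; rewrite -[v k](rowK (fun i => v i)) row_sub.
Qed.

Lemma exchange_comb v k c :
  D (replace_at v k (c *m \matrix_i v i)) = c 0 k * D v.
Proof.
set M := \matrix_i v i; have [Mu|Ms] := boolP (M \in unitmx).
  (* The exchange identity at [b = c *m M], as an equality of two combinations of the rows of [M];
     cancelling [M] compares coordinates. *)
  have E : (D v *: c) *m M = (\row_l D (replace_at v l (c *m M))) *m M.
    rewrite -scalemxAl exD [RHS]mulmx_sum_row; apply: eq_bigr => l _.
    by rewrite rowK mxE.
  by move/(can_inj (mulmxK Mu))/rowP/(_ k): E; rewrite !mxE mulrC => <-.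
(* The new entries stay in the row space of [M], so the modified family is singular as well and both
   sides vanish. *)
rewrite (exchange_singular Ms) mulr0; apply: exchange_singular.
apply: contraNN Ms; rewrite -!row_full_unit -!sub1mx => /submx_trans; apply.
apply/row_subP => i; rewrite rowK ffunE; case: eqP => _; first exact: submxMl.
by rewrite -[v i](rowK (fun i => v i)) row_sub.
Qed.

Lemma exchange_comb2 v i j (a b : F) : i != j ->
  D (replace_at v i (a *: v i + b *: v j)) = a * D v.
Proof.
move=> neq_ij.
have -> : a *: v i + b *: v j =
    (a *: delta_mx 0 i + b *: delta_mx 0 j) *m \matrix_i v i.
  by rewrite mulmxDl -!scalemxAl -!rowE !rowK.
by rewrite exchange_comb !mxE !eqxx (negPf neq_ij) mulr1 mulr0 addr0.
Qed.

(** Replacing [v i] by [0 *: v i + 1 *: v j] leaves [v] unchanged, yet multiplies [D v] by [0]. *)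
Lemma exchange_repeat v i j : i != j -> v i = v j -> D v = 0.
Proof.
move=> neq_ij v_ij; rewrite -[RHS](mul0r (D v)) -(exchange_comb2 v 0 1 neq_ij).
congr D; apply/ffunP => l; rewrite ffunE scale0r add0r scale1r -v_ij.
by case: eqP => [->|].
Qed.

Lemma exchange_tperm v i j : i != j -> D [ffun l => v (tperm i j l)] = - D v.
Proof.
move=> neq_ij; have neq_ji : j != i by rewrite eq_sym.
(* With [x = v i] and [y = v j], the entries at [i] and [j] go from [(x, y)] to [(x + y, y)],
   [(x + y, x)] and [(y, x)]; the factors are [1], [-1] and [1]. *)
pose v1 := replace_at v i (1 *: v i + 1 *: v j).
pose v2 := replace_at v1 j ((-1) *: v1 j + 1 *: v1 i).
pose v3 := replace_at v2 i (1 *: v2 i + (-1) *: v2 j).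
have -> : [ffun l => v (tperm i j l)] = v3.
  apply/ffunP => l; rewrite !ffunE !eqxx (negPf neq_ij) (negPf neq_ji).
  rewrite !scale1r !scaleN1r.
  case: tpermP => [->|->|/eqP/negPf-> /eqP/negPf->//].
    by rewrite eqxx opprD opprK addrC subrK.
  by rewrite (negPf neq_ji) eqxx [v i + v j]addrC addKr.
by rewrite !exchange_comb2 // !mul1r mulN1r.
Qed.

End ExchangeTheory.

Section Uniqueness.

Variables (F : fieldType) (n : nat) (D1 D2 : ('rV[F]_n ^ n)%type -> F).
Hypotheses (ex1 : exchange D1) (ex2 : exchange D2).
Hypothesis eq_std : D1 (std_basis F n) = D2 (std_basis F n).
Implicit Types (v : ('rV[F]_n ^ n)%type).

Lemma exchange_unique_perm (s : 'S_n) :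
  D1 [ffun i => delta_mx 0 (s i)] = D2 [ffun i => delta_mx 0 (s i)].
Proof.
have [ts -> ts_neq] := prod_tpermP s.
elim: ts ts_neq => [_|t ts IH /= /andP[t_neq ts_neq]].
  have id_std : [ffun i => delta_mx 0 ((1%g : 'S_n) i)] = std_basis F n.
    by apply/ffunP => i; rewrite !ffunE perm1.
  by rewrite big_nil id_std.
rewrite big_cons; set u := (\prod_(_ <- _) _)%g in IH *.
pose v : ('rV[F]_n ^ n)%type := [ffun i => delta_mx 0 (u i)].
have -> : [ffun i => delta_mx 0 ((tperm t.1 t.2 * u)%g i)] =
    [ffun l => v (tperm t.1 t.2 l)] :> ('rV[F]_n ^ n)%type.
  by apply/ffunP => i; rewrite !ffunE permM.
by rewrite !exchange_tperm // (IH ts_neq).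
Qed.

Lemma exchange_unique_basis (f : 'I_n -> 'I_n) :
  D1 [ffun i => delta_mx 0 (f i)] = D2 [ffun i => delta_mx 0 (f i)].
Proof.
have [/injectiveP f_inj|] := boolP (injectiveb f).
  have -> : [ffun i => delta_mx 0 (f i)] =
      [ffun i => delta_mx 0 (perm f_inj i)] :> ('rV[F]_n ^ n)%type.
    by apply/ffunP => i; rewrite !ffunE permE.
  exact: exchange_unique_perm.
case/injectivePn => i [j neq_ij f_ij].
rewrite (exchange_repeat ex1 neq_ij) ?ffunE ?f_ij //.
by rewrite (exchange_repeat ex2 neq_ij) ?ffunE ?f_ij.
Qed.

(** For invertible [M], the vector [delta_mx 0 j] has coordinate [invmx M j k] on row [k] of [M], so
    the replacement multiplies both functions by this scalar, which can be cancelled for a suitable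
    [j]. *)
Lemma exchange_unique_replace v k :
  (forall j, D1 (replace_at v k (delta_mx 0 j)) =
             D2 (replace_at v k (delta_mx 0 j))) ->
  D1 v = D2 v.
Proof.
move=> eq_repl; set M := \matrix_i v i.
have [Mu|Ms] := boolP (M \in unitmx); last by rewrite !exchange_singular.
(* A zero column [k] of [invmx M] would make entry [(k, k)] of [M *m invmx M] zero. *)
have [j Mjk] : exists j, invmx M j k != 0.
  apply/existsP; apply: contraT; rewrite negb_exists => /forallP inv0.
  have /matrixP/(_ k k)/eqP := mulmxV Mu.
  rewrite !mxE eqxx big1 ?(eq_sym 0) ?oner_eq0 // => j _.
  by have := inv0 j; rewrite negbK => /eqP->; rewrite mulr0.
apply: (mulfI Mjk); have := eq_repl j.
have -> : delta_mx 0 j = row j (invmx M) *m M.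
  by rewrite -row_mul mulVmx // row1.
by rewrite !exchange_comb // !mxE.
Qed.

Lemma exchange_unique v : D1 v = D2 v.
Proof.
(* Induction on [m], the number of leading entries that may still differ from standard basis
   vectors; at [m = n] the condition is void. *)
suff main m (w : ('rV[F]_n ^ n)%type) :
    (forall i : 'I_n, (m <= i)%N -> exists j : 'I_n, w i = delta_mx 0 j) ->
    D1 w = D2 w.
  by apply: (main n) => i; rewrite leqNgt ltn_ord.
elim: m w => [|m IH] w w_std.
  have [f wf] := fin_all_exists (fun i => w_std i isT).
  have -> : w = [ffun i => delta_mx 0 (f i)] by apply/ffunP => i; rewrite ffunE.
  exact: exchange_unique_basis.
have [lt_mn|le_nm] := ltnP m n; last first.
  by apply: IH => i /(leq_trans le_nm); rewrite leqNgt ltn_ord.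
apply: (@exchange_unique_replace w (Ordinal lt_mn)) => j; apply: IH => i le_mi.
rewrite ffunE; case: eqP => [_|/eqP neq_im]; first by exists j.
by apply: w_std; rewrite ltn_neqAle eq_sym neq_im.
Qed.

End Uniqueness.

Lemma std_determinantE (F : fieldType) (n : nat)
    (D : ('rV[F]_n ^ n)%type -> F) (v : ('rV[F]_n ^ n)%type) :
  is_std_determinant D -> D v = \det (\matrix_i v i).
Proof.
case=> [[_ exD _] D_std].
apply: (exchange_unique exD (@det_exchange F n)); rewrite D_std -(det1 F n).
by congr (\det _); apply/row_matrixP => i; rewrite rowK ffunE row1.
Qed.

Theorem corollary4p8 (F : fieldType) (n : nat) (n_gt0 : (0 < n)%N)
    (det : ('rV[F]_n ^ n)%type -> F) (det_std : is_std_determinant det)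
    (A : 'M[F]_n) :
  det (mx_rows A^T) = det (mx_rows A).
Proof.
have rowsK (B : 'M[F]_n) : \matrix_i mx_rows B i = B.
  by apply/row_matrixP => i; rewrite rowK ffunE.
by rewrite !std_determinantE // !rowsK det_tr.
Qed.
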